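(* Let $k \geq 1$ and $n \in \mathbb{N}$, let $\gamma, \beta \in [0,1]$ and let $q$ be a prime power. Every $(k, \gamma q^k, \beta)$-Furstenberg set $K \subseteq \mathbb{F}_q^n$ satisfies $$|K| \geq \beta \gamma^n q^n \left(1 + \frac{1}{q^{k-1}}\right)^{-n}.$$
   Context: $\mathcal{L}_k^*(\mathbb{F}_q^n)$ denotes the set of $k$-dimensional linear subspaces of $\mathbb{F}_q^n$. A flat $R$ is $m$-rich with respect to $K$ if $|R \cap K| \geq m$. A set $K \subset \mathbb{F}_q^n$ is a $(k, m, \beta)$-Furstenberg set if for at least a $\beta$-fraction of all $A \in \mathcal{L}_k^*(\mathbb{F}_q^n)$ there exists $a \in \mathbb{F}_q^n$ such that $a + A$ is $m$-rich with respect to $K$.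
   Formalization: The formal theorem also assumes k ≤ n; for k > n there are no k-dimensional subspaces, so the Furstenberg condition is vacuous and the claim fails for the empty set K with β = γ = 1. *)

(* Defs.v *)
From HB Require Import structures.
From mathcomp Require Import all_boot all_order all_algebra all_field.
From mathcomp Require Import reals.
Set Implicit Arguments. Unset Strict Implicit. Unset Printing Implicit Defensive.
Import Order.TTheory GRing.Theory Num.Theory.
Local Open Scope ring_scope.

(* F^n is 'rV[F]_n.  A linear subspace of F^n is represented canonically by a
   square matrix A : 'M[F]_n with A = <<A>>%MS (its row space is the subspace;
   <<_>>%MS is the canonical representative, so subspaces correspond bijectively
   to such matrices). *)
Definition Lk (F : finFieldType) (n k : nat) : {set 'M[F]_n} :=
  [set A : 'M[F]_n | (<<A>>%MS == A) && (\rank A == k)%N].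

Definition flat_meet (F : finFieldType) (n : nat) (K : {set 'rV[F]_n})
  (a : 'rV[F]_n) (A : 'M[F]_n) : nat :=
  #|[set x in K | (x - a <= A)%MS]|.

Definition furstenberg (R : realType) (F : finFieldType) (n k : nat) (m beta : R)
  (K : {set 'rV[F]_n}) : Prop :=
  beta * (#|Lk F n k|)%:R <=
  (#|[set A in Lk F n k | [exists a : 'rV[F]_n, (m <= (flat_meet K a A)%:R)]]|)%:R.

(* Main.v *)
Require Import Defs.
From HB Require Import structures.
From mathcomp Require Import all_boot all_order all_algebra all_field.
From mathcomp Require Import reals.
From mathcomp Require Import zify ring lra.
Import Order.TTheory GRing.Theory Num.Theory.
Local Open Scope ring_scope.

(** Polynomial method with multiplicities over the degree [k] extension [L] of
    [F = F_q].  For [w] in [L^n] the trace curve [t |-> a + Tr (t w^q)] parametrizes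
    a flat of [F^n] of dimension at most [k] by polynomials in [t] of degree
    [q^(k-1)] with leading coefficient [w], since [w^(q^k) = w].  If a polynomial
    vanishes to high order on [K] and this curve meets [K] for at least
    [gamma q^k] values of [t], then its top degree part vanishes to order [> l] at
    [w].  Jets of order [<= l] on [L^n] separate polynomials of degree
    [D < q^k (l+1)], so one can fix a basis of ['C(n+D, n)] such jets; the number of
    them based at rich points [w] is then at most [#|K|] times the number of jets of
    order [<= m] at one point.  Replacing [K] by its images under GL_n(F) and
    averaging, at least a fraction [beta] of the chosen basis is rich, because every
    trace curve lies in some [k]-flat and GL_n(F) is transitive on these.  The bound
    follows by letting [l] tend to infinity. *)

(** * Nonsingular minors and univariate Hermite interpolation *)

(** Row rank equals column rank, so independent rows admit a nonsingular square minor, whose columns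
    [f] selects. The conclusion passes from relations among rows to relations among columns, so the
    lemma can be applied again with the two sides exchanged. *)
Lemma free_transversal {K : fieldType} {I J : finType} {B : I -> J -> K} :
    (forall c : I -> K, (forall j, \sum_i c i * B i j = 0) -> forall i, c i = 0) ->
  exists2 f : I -> J, injective f &
    forall d : I -> K, (forall i, \sum_i' d i' * B i (f i') = 0) ->
    forall i, d i = 0.
Proof.
move=> indep.
pose M : 'M[K]_(#|I|, #|J|) := \matrix_(i, j) B (enum_val i) (enum_val j).
have freeM : row_free M.
  rewrite -kermx_eq0; apply/rowV0P => v /sub_kermxP vM0; apply/rowP => i.
  rewrite mxE -(enum_valK i); apply: (indep (fun i => v 0 (enum_rank i))) => j.
  move/rowP: vM0 => /(_ (enum_rank j)); rewrite !mxE => vM0.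
  rewrite -[RHS]vM0 (reindex _ (onW_bij _ (@enum_val_bij I))) /=; apply: eq_bigr => i' _.
  by rewrite !mxE enum_valK enum_rankK.
have fullMT : row_full M^T by rewrite /row_full mxrank_tr.
pose g := fullrankfun fullMT.
exists (fun i => enum_val (g (enum_rank i))).
  by move=> i1 i2 /enum_val_inj/fullrankfun_inj/enum_rank_inj.
move=> d dM0; have := fullrowsub_full fullMT.
rewrite row_full_unit -/g -row_free_unit => /row_free_inj inj_g i.
have /rowP/(_ (enum_rank i)): \row_j d (enum_val j) = 0 :> 'rV[K]_#|I|.
  apply: (inj_g 1%N); rewrite mul0mx; apply/rowP => j; rewrite !mxE.
  rewrite -[RHS](dM0 (enum_val j)).
  rewrite [RHS](reindex _ (onW_bij _ (@enum_val_bij I))) /=.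
  by apply: eq_bigr => i' _; rewrite !mxE enum_valK.
by rewrite !mxE enum_rankK.
Qed.

(** Powers of distinct linear factors are coprime, so their product, of degree [#|S| * r], divides
    [p]; a nonzero [p] is too small for that. *)
Lemma dvdp_root_multiplicities {K : finFieldType} (S : {set K}) (r : nat)
    (p : {poly K}) :
    (forall x, x \in S -> ('X - x%:P) ^+ r %| p) ->
    (size p <= #|S| * r)%N -> p = 0.
Proof.
move=> dvd_p szp; have [//|p_neq0] := eqVneq p 0.
suff /(dvdp_leq p_neq0): \prod_(x in S) ('X - x%:P) ^+ r %| p.
  rewrite size_prod => [|x _]; last by rewrite expf_neq0 ?polyXsubC_eq0.
  under eq_bigr do rewrite size_exp_XsubC -addn1.
  by rewrite big_split /= !sum_nat_const muln1 -addSn addnK ltnNge szp.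
rewrite -big_enum /=.
have: all [in S] (enum S) by apply/allP => x; rewrite mem_enum.
elim: (enum S) (enum_uniq S) => [|x s IHs] /=; first by rewrite big_nil dvd1p.
case/andP=> x_s uniq_s /andP[xS sS].
rewrite big_cons Gauss_dvdp ?dvd_p ?IHs // big_seq.
apply: (big_ind (coprimep _)) => [|q1 q2|y y_s]; first exact: coprimep1.
  by move=> ? ?; rewrite coprimepMr; apply/andP.
rewrite coprimep_expl // coprimep_expr // coprimep_XsubC2 // subr_eq0.
by apply: contraNneq x_s => <-.
Qed.

(* Jets of order at most [e %/ #|K|] at all points determine a univariate polynomial
   of degree at most [e]; [lam] computes its coefficient of index [e] from them. *)
Lemma hermite_functional {K : finFieldType} (e l : nat) :
    (e < #|K| * l.+1)%N ->
  exists lam : K * 'I_l.+1 -> K,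
    (forall xa, lam xa != 0 -> (#|K| * xa.2 <= e)%N) /\
    forall e' : nat, (e' <= e)%N ->
    \sum_xa lam xa * ('C(e', xa.2)%:R * xa.1 ^+ (e' - xa.2)) = (e' == e)%:R.
Proof.
move=> lt_e; have K_gt0 : (0 < #|K|)%N by apply/card_gt0P; exists 0.
(* This is the least order for which [#|K| * b.+1] exceeds [e]; keeping to jets of order at most [b]
   yields the support condition on [lam]. *)
pose b := (e %/ #|K|)%N.
have le_bl : (b.+1 <= l.+1)%N by rewrite ltn_divLR // mulnC.
have lt_eb : (e < #|K| * b.+1)%N by rewrite mulnC ltn_ceil.
pose B (i : 'I_e.+1) (xa : K * 'I_b.+1) : K :=
  'C(i, xa.2)%:R * xa.1 ^+ (i - xa.2).
have indep (c : 'I_e.+1 -> K) :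
  (forall xa, \sum_i c i * B i xa = 0) -> forall i, c i = 0.
  (* A relation among the rows is a polynomial of degree at most [e] whose Hasse derivatives of
     order at most [b] vanish at every point of [K]. *)
  move=> cB0; pose p := \poly_(i < e.+1) c (inord i).
  suff p0 i : c i = 0 by [].
  have ->: c i = p`_i by rewrite coef_poly ltn_ord inord_val.
  suff ->: p = 0 by rewrite coef0.
  apply: (@dvdp_root_multiplicities _ [set: K] b.+1); last first.
    by rewrite cardsT (leq_trans (size_poly _ _)).
  move=> x _; rewrite /p poly_def.
  have expand (j : 'I_e.+1) : c (inord j) *: 'X^j =
      \sum_(a < e.+1) (c j * ('C(j, a)%:R * x ^+ (j - a)))%:P
        * ('X - x%:P) ^+ a.
    rewrite inord_val -{1}['X](subrK x%:P) addrC exprDn scaler_sumr.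
    rewrite (big_ord_widen e.+1 (fun a => c j *: (x%:P ^+ (j - a) *
       ('X - x%:P) ^+ a *+ 'C(j, a)))) ?ltn_ord //=.
    rewrite big_mkcond; apply: eq_bigr => a _; case: ltnP => [_|lt_a].
      rewrite -mul_polyC !polyCM polyC_natr polyC_exp -mulr_natl.
      by rewrite !mulrA.
    by rewrite bin_small // mul0r mulr0 mul0r.
  rewrite (eq_bigr _ (fun j _ => expand j)) exchange_big /=.
  apply: (big_rec (dvdp _)) => [|a q _ dvd_q]; first exact: dvdp0.
  rewrite dvdp_addr // -big_distrl /= -rmorph_sum /=.
  have [le_a|lt_a] := leqP a b; last by rewrite dvdp_mull // dvdp_exp2l.
  have /= := cB0 (x, Ordinal (le_a : (a < b.+1)%N)).
  by rewrite /B /= => ->; rewrite mul0r dvdp0.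
have [f _ freef] := free_transversal indep.
pose M : 'M[K]_e.+1 := \matrix_(i, j) B i (f j).
have unitM : M^T \in unitmx.
  rewrite -row_free_unit -kermx_eq0; apply/rowV0P => v /sub_kermxP /rowP vM.
  apply/rowP => i; rewrite mxE; apply: freef => j; have := vM j.
  rewrite !mxE => vMj; rewrite -[RHS]vMj.
  by apply: eq_bigr => k _; rewrite !mxE.
pose v : 'rV_e.+1 := delta_mx 0 ord_max *m invmx M^T.
pose h i := ((f i).1, widen_ord le_bl (f i).2).
exists (fun xa => \sum_(i | h i == xa) v 0 i); split=> [xa|e' le_e'].
  apply: contraNT; rewrite -ltnNge => lt_xa; rewrite big_pred0 // => i.
  apply: contraTF lt_xa => /eqP <-; rewrite -leqNgt /= mulnC.
  by rewrite -leq_divRL // -ltnS.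
have /matrixP/(_ 0 (inord e')) : v *m M^T = delta_mx 0 ord_max.
  by rewrite mulmxKV.
rewrite !mxE eqxx -val_eqE /= inordK ?ltnS // => <-.
under eq_bigr do rewrite big_distrl /=.
rewrite (exchange_big_dep predT) //=; apply: eq_bigr => i _.
rewrite (big_pred1 (h i)) => [|j]; last by rewrite /= eq_sym.
by rewrite !mxE /B inordK.
Qed.

(** * Jets of monomials in several variables *)

Lemma leq_sum_term {I : finType} (F : I -> nat) (i : I) : (F i <= \sum_i F i)%N.
Proof. by rewrite (bigD1 i) //= leq_addr. Qed.

(* The Hasse derivative of index [a] of the monomial of exponents [e], at [x]. *)
Definition jet {R : comNzRingType} {n : nat} (x : 'I_n -> R)
    (a e : 'I_n -> nat) : R :=
  \prod_i ('C(e i, a i)%:R * x i ^+ (e i - a i)).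

Lemma jet_eq0 {R : comNzRingType} {n : nat} (x : 'I_n -> R) (a e : 'I_n -> nat)
    (i : 'I_n) : (e i < a i)%N -> jet x a e = 0.
Proof. by move=> lt_ea; rewrite /jet (bigD1 i) //= bin_small // !mul0r. Qed.

(** Choose [t0] of maximal total degree with [c t0 != 0]. The product over the coordinates of the
    functionals of [hermite_functional] for the exponents of [t0] extracts [c t0] from the jets. *)
Lemma jets_determine {K : finFieldType} {n l : nat} {T : finType}
    (E : T -> 'I_n -> nat) (c : T -> K) :
    (forall t1 t2, E t1 =1 E t2 -> t1 = t2) ->
    (forall t, \sum_i E t i < #|K| * l.+1)%N ->
    (forall y : {ffun 'I_n -> K * 'I_l.+1}, (\sum_i (y i).2 <= l)%N ->
      \sum_t c t * jet (fun i => (y i).1) (fun i => (y i).2) (E t) = 0) ->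
  forall t, c t = 0.
Proof.
move=> injE ltE jet0 t; apply/eqP/negP => /negP ct0.
have K_gt0 : (0 < #|K|)%N by apply/card_gt0P; exists 0.
have [t0 {}ct0 t0_max] := @arg_maxnP T t (fun t => c t != 0) (fun t => (\sum_i E t i)%N) ct0.
have lam_ex i := @hermite_functional K (E t0 i) l
   (leq_ltn_trans (leq_sum_term (E t0) i) (ltE t0)).
have [lam lamP] := fin_all_exists lam_ex.
have: \sum_(y : {ffun 'I_n -> K * 'I_l.+1}) (\prod_i lam i (y i)) *
  (\sum_t c t * jet (fun i => (y i).1) (fun i => (y i).2) (E t)) = 0.
  apply: big1 => y _; have [le_y|lt_y] := leqP (\sum_i (y i).2) l.
    by rewrite jet0 // mulr0.
  have [i /eqP lam0|lam_n0] := pickP (fun i => lam i (y i) == 0).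
    by rewrite (bigD1 i) //= lam0 !mul0r.
  (* Nonzero factors [lam i (y i)] force [#|K|] times the total order to be at most the degree of
     [t0], so orders above [l] do not contribute. *)
  have: (#|K| * (\sum_i (y i).2) <= \sum_i E t0 i)%N.
    rewrite big_distrr; apply: leq_sum => i _.
    by have [+ _] := lamP i; apply; rewrite lam_n0.
  rewrite leqNgt (leq_trans (ltE t0)) // leq_pmul2l //.
have sumE t1 : \sum_(y : {ffun 'I_n -> K * 'I_l.+1}) (\prod_i lam i (y i)) *
    (c t1 * jet (fun i => (y i).1) (fun i => (y i).2) (E t1)) =
  c t1 * \prod_i \sum_xa
    lam i xa * ('C(E t1 i, xa.2)%:R * xa.1 ^+ (E t1 i - xa.2)).
  rewrite bigA_distr_bigA big_distrr; apply: eq_bigr => y _ /=.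
  by rewrite mulrCA -big_split.
under eq_bigr do rewrite big_distrr /=.
rewrite exchange_big /=; under eq_bigr do rewrite sumE.
rewrite (bigD1 t0) //= big1 ?mulr1 => [|i _]; last first.
  by have [_ ->] := lamP i; rewrite ?eqxx.
rewrite big1 ?addr0 => [/eqP|t1 t1n0]; first by rewrite (negPf ct0).
have [->|ct1] := eqVneq (c t1) 0; first by rewrite mul0r.
(* A monomial with some exponent below that of [t0] is killed by the corresponding [lam i]; any
   other dominates [t0], and equals it by maximality of the degree. *)
have [i lt_i|ge_E] := pickP (fun i => (E t1 i < E t0 i)%N).
  have [_ lam_i] := lamP i.
  by rewrite (bigD1 i) //= lam_i ?(ltnW lt_i) // (ltn_eqF lt_i) mul0r mulr0.
case/eqP: t1n0; apply: injE => i; apply/esym/eqP.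
have leE j : (E t0 j <= E t1 j)%N by rewrite leqNgt ge_E.
rewrite eqn_leq leE leqNgt; apply/negP => lt_i.
have /= := t0_max t1 ct1; rewrite leqNgt => /negP; apply.
rewrite (bigD1 i) //= [ltnRHS](bigD1 i) //= -addSn leq_add //.
by apply: leq_sum.
Qed.

Lemma mul_bin_bin (e a j : nat) :
  ('C(e, a) * 'C(e - a, j) = 'C(a + j, a) * 'C(e, a + j))%N.
Proof.
have [le_aj|lt_aj] := leqP (a + j) e; last first.
  rewrite (bin_small lt_aj) muln0; have [le_ae|/bin_small-> //] := leqP a e.
  by rewrite (@bin_small (e - a)) ?muln0 // ltn_subLR.
have le_ae := leq_trans (leq_addr j a) le_aj.
have le_j : (j <= e - a)%N by rewrite leq_subRL.
have fact_pos : (0 < a`! * j`! * (e - (a + j))`!)%N.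
  by rewrite !muln_gt0 !fact_gt0.
apply/eqP; rewrite -(eqn_pmul2r fact_pos); apply/eqP.
have := bin_fact le_ae; have := bin_fact le_j; have := bin_fact le_aj.
have := bin_fact (leq_addr j a); rewrite addKn subnDA => E1 E2 E3 E4.
rewrite -{}E1 in E2; rewrite -{}E3 in E4.
by transitivity e`!; [rewrite -E4 | rewrite -E2]; lia.
Qed.

(** * Polynomials restricted to a curve *)

(** The value [x] may be zero, so [s] only bounds the degree; this keeps the product rule free of
    side conditions. *)
Definition top_coef {R : comNzRingType} (s : nat) (p : {poly R}) (x : R) :=
  (size p <= s.+1)%N /\ p`_s = x.

Lemma top_coef_mul {R : comNzRingType} (s1 s2 : nat) (p1 p2 : {poly R})
    (x1 x2 : R) :
  top_coef s1 p1 x1 -> top_coef s2 p2 x2 ->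
  top_coef (s1 + s2) (p1 * p2) (x1 * x2).
Proof.
move=> [sz1 <-] [sz2 <-]; split.
  by apply: leq_trans (size_polyMleq _ _) _; lia.
have lt_s : (s1 < (s1 + s2).+1)%N by rewrite ltnS leq_addr.
rewrite coefM (bigD1 (Ordinal lt_s)) //= addKn big1 ?addr0 // => j.
rewrite -val_eqE /= neq_ltn => /orP[lt_j|gt_j].
  rewrite (nth_default 0 (s := p2)) ?mulr0 // (leq_trans sz2) //; lia.
by rewrite (nth_default 0 (s := p1)) ?mul0r // (leq_trans sz1).
Qed.

Lemma top_coef_exp {R : comNzRingType} (s m : nat) (p : {poly R}) (x : R) :
  top_coef s p x -> top_coef (m * s) (p ^+ m) (x ^+ m).
Proof.
move=> top_p; elim: m => [|m IHm]; last by rewrite !exprS mulSn; apply: top_coef_mul.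
by split; rewrite ?size_poly1 ?coef1.
Qed.

Lemma top_coef_jet {R : comNzRingType} {n : nat} (r : nat)
    (g : 'I_n -> {poly R}) (w : 'I_n -> R) (a e : 'I_n -> nat) :
    (forall i, top_coef r (g i) (w i)) ->
  top_coef ((\sum_i e i - \sum_i a i) * r) (jet g a e) (jet w a e).
Proof.
(* If some exponent lies below its order, both jets are zero; otherwise the truncated subtractions
   add up exactly. *)
move=> top_g; have [i lt_i|le_ae] := pickP (fun i => (e i < a i)%N).
  by rewrite !(@jet_eq0 _ _ _ _ _ i) //; split; rewrite ?size_poly0 ?coef0.
have -> : (\sum_i e i - \sum_i a i = \sum_i (e i - a i))%N.
  rewrite sumnB // => i _; by rewrite leqNgt le_ae.
rewrite big_distrl /= /jet; elim/big_rec3: _ => [|i x p s _ IH].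
  by split; rewrite ?size_poly1 ?coef1.
apply: top_coef_mul => //; rewrite -[X in top_coef X]add0n.
apply: top_coef_mul; last exact: top_coef_exp.
by rewrite -polyC_natr; split; rewrite ?coefC // size_polyC leq_b1.
Qed.

(** Taylor expansion in each coordinate, rearranged by [mul_bin_bin]. The range [N] is free so that
    one index set serves all monomials of a polynomial. *)
Lemma jet_taylor {R : comNzRingType} {n : nat} (N : nat) (x h : 'I_n -> R)
    (a e : 'I_n -> nat) : (forall i, e i < N)%N ->
  jet (fun i => x i + h i) a e =
  \sum_(j : {ffun 'I_n -> 'I_N})
    (\prod_i ('C(a i + j i, a i)%:R * h i ^+ j i)) *
    jet x (fun i => a i + j i)%N e.
Proof.
move=> ltN; rewrite /jet.
under [RHS]eq_bigr do rewrite -big_split.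
rewrite -(bigA_distr_bigA (fun i (j : 'I_N) => 'C(a i + j, a i)%:R * h i ^+ j *
  ('C(e i, a i + j)%:R * x i ^+ (e i - (a i + j))))).
apply: eq_bigr => i _; rewrite exprDn.
rewrite (big_ord_widen N (fun j => x i ^+ (e i - a i - j) * h i ^+ j
  *+ 'C(e i - a i, j))); last by rewrite (leq_ltn_trans (leq_subr _ _)).
rewrite big_mkcond big_distrr; apply: eq_bigr => j _ /=.
have -> : 'C(a i + j, a i)%:R * h i ^+ j *
    ('C(e i, a i + j)%:R * x i ^+ (e i - (a i + j))) =
  'C(e i, a i)%:R * (x i ^+ (e i - a i - j) * h i ^+ j *+ 'C(e i - a i, j)).
  rewrite -[_ *+ 'C(e i - a i, j)]mulr_natl [in RHS]mulrA -natrM mul_bin_bin natrM subnDA.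
  by rewrite mulrACA [h i ^+ j * _]mulrC.
by case: ltnP => // lt_j; rewrite (bin_small lt_j) ?mulr0n ?mulr0.
Qed.

(* Along the curve [g] the derivative of index [a] of the polynomial with
   coefficients [c] has too many zeros, hence vanishes; its leading coefficient in
   the curve parameter is the value at [w] of the same derivative of the top degree
   part. *)
Lemma top_degree_jet_eq0 {K : finFieldType} {n : nat} {T : finType}
    (E : T -> 'I_n -> nat) (c : T -> K) (d m l r : nat)
    (g : 'I_n -> {poly K}) (w : 'I_n -> K) (S : {set K}) :
    (0 < r)%N ->
    (forall t, c t != 0 -> (\sum_i E t i <= d)%N) ->
    (forall i, top_coef r (g i) (w i)) ->
    (forall x, x \in S -> forall a : 'I_n -> nat, (\sum_i a i <= m)%N ->
      \sum_t c t * jet (fun i => (g i).[x]) a (E t) = 0) ->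
    (d * r < #|S| * (m.+1 - l))%N ->
  forall a : 'I_n -> nat, (\sum_i a i <= l)%N ->
    \sum_(t | (\sum_i E t i == d)%N) c t * jet w a (E t) = 0.
Proof.
move=> r_gt0 degE top_g vanish lt_d a le_a.
pose p := \sum_t (c t)%:P * jet g a (E t).
have p0 : p = 0.
  apply: (@dvdp_root_multiplicities _ S (m.+1 - l)) => [x xS|]; last first.
    apply: leq_trans lt_d; rewrite /p.
    apply: (big_ind (fun p : {poly K} => size p <= (d * r).+1)%N) => [|u v su sv|t _].
    - by rewrite size_poly0.
    - by rewrite (leq_trans (size_polyD _ _)) // geq_max su.
    have [->|ct0] := eqVneq (c t) 0; first by rewrite mul0r size_poly0.
    rewrite mul_polyC (leq_trans (size_scale_leq _ _)) //.
    have [+ _] := top_coef_jet r g w a (E t) top_g.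
    move/leq_trans; apply; rewrite ltnS leq_mul2r.
    by rewrite (leq_trans (leq_subr _ _)) ?degE ?orbT.
  pose h i := g i - (g i).[x]%:P.
  pose N := (\sum_t \sum_i E t i).+1.
  have ltN t i : (E t i < N)%N.
    by rewrite ltnS (leq_trans (leq_sum_term (E t) i)) // (leq_sum_term (fun t => \sum_i E t i)%N).
  have jet_g t : jet g a (E t) = \sum_(j : {ffun 'I_n -> 'I_N})
    (\prod_i ('C(a i + j i, a i)%:R * h i ^+ j i)) *
    (jet (fun i => (g i).[x]) (fun i => a i + j i)%N (E t))%:P.
    have -> : jet g a (E t) = jet (fun i => (g i).[x]%:P + h i) a (E t).
      by apply: eq_bigr => i _; rewrite addrC subrK.
    rewrite (jet_taylor N) //; apply: eq_bigr => j _; congr (_ * _).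
    rewrite /jet rmorph_prod; apply: eq_bigr => i _.
    by rewrite rmorphM rmorph_nat rmorphXn.
  have -> : p = \sum_(j : {ffun 'I_n -> 'I_N})
    (\prod_i ('C(a i + j i, a i)%:R * h i ^+ j i)) *
    (\sum_t c t * jet (fun i => (g i).[x]) (fun i => a i + j i)%N (E t))%:P.
    rewrite /p; under eq_bigr do rewrite jet_g big_distrr /=.
    rewrite exchange_big; apply: eq_bigr => j _ /=.
    rewrite rmorph_sum big_distrr; apply: eq_bigr => t _ /=.
    by rewrite mulrCA rmorphM.
  apply: (big_rec (dvdp _)) => [|j q _ dvd_q]; first exact: dvdp0.
  (* Taylor terms of total order at most [m] vanish by hypothesis. In the others [\sum_i j i] is at
     least [m.+1 - l], and each [h i] is divisible by ['X - x%:P]. *)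
  rewrite dvdp_addr //; have [le_m|lt_m] := leqP (\sum_i (a i + j i)) m.
    by rewrite vanish // mulr0 dvdp0.
  apply/dvdp_mulr/(@dvdp_trans _ (('X - x%:P) ^+ \sum_i j i)).
    apply: dvdp_exp2l; rewrite leq_subLR (leq_trans lt_m) // big_split /=.
    by rewrite leq_add2r.
  rewrite -prodrXr; elim/big_rec2: _ => [|i u v _ dvd_uv]; first exact: dvdpp.
  apply: dvdp_mul => //; apply/dvdp_mull/dvdp_exp2r.
  by rewrite dvdp_XsubCl /root !hornerE subrr.
have: p`_((d - \sum_i a i) * r) = 0 by rewrite p0 coef0.
rewrite coef_sum (bigID (fun t => \sum_i E t i == d)%N) /=.
rewrite [X in _ + X]big1 ?addr0 => [p_top|t degt].
  rewrite -{}[RHS]p_top; apply: eq_bigr => t /eqP <-; rewrite coefCM.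
  by have [_ ->] := top_coef_jet r g w a (E t) top_g.
rewrite coefCM; have [->|ct0] := eqVneq (c t) 0; first by rewrite mul0r.
have lt_Ed : (\sum_i E t i < d)%N by rewrite ltn_neqAle degt degE.
(* Lower degree terms do not reach this coefficient: either the jet is zero, or the order of [a] is
   below [d] and the strict inequality survives truncated subtraction. *)
have [i lt_i|le_aE] := pickP (fun i => (E t i < a i)%N).
  by rewrite (jet_eq0 _ _ _ i) // coef0 mulr0.
rewrite nth_default ?mulr0 //.
have [+ _] := top_coef_jet r g w a (E t) top_g.
move/leq_trans; apply; rewrite ltn_pmul2r // ltn_sub2r //.
apply: leq_ltn_trans lt_Ed; apply: leq_sum => i _.
by rewrite leqNgt le_aE.
Qed.

(** * The field extension of degree [k] *)

(** In a splitting field of ['X^m - 'X] the roots are the fixed points of the [k]-th power of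
    Frobenius. They form a subfield and generate the field, so they fill it; separability counts [m]
    of them. *)
Lemma finField_extension (F : finFieldType) (k : nat) : (0 < k)%N ->
  exists (L : finFieldType) (iota : {rmorphism F -> L}) (b : 'I_k -> L),
    [/\ #|L| = (#|F| ^ k)%N,
        forall y : L, y ^+ #|F| = y -> exists c, iota c = y
      & forall y : L, exists c : 'I_k -> F, y = \sum_i iota (c i) * b i].
Proof.
move=> k_gt0; pose m := (#|F| ^ k)%N.
have F_gt1 : (1 < #|F|)%N := finNzRing_gt1 F.
have m_gt1 : (1 < m)%N by rewrite (ltn_exp2l 0).
have m1_gt0 : (0 < m.-1)%N by rewrite -ltnS prednK ?(ltnW m_gt1).
pose q (R : nzRingType) : {poly R} := 'X^m - 'X.
have Dq R : q R = ('X^(m.-1) - 1) * ('X - 0).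
  by rewrite subr0 mulrBl mul1r -exprSr prednK ?(ltnW m_gt1).
have /FinSplittingFieldFor[/= L splitLq] : q F != 0.
  by rewrite -size_poly_gt0 size_polyDl size_polyXn // size_polyN size_polyX.
rewrite [map_poly _ _]rmorphB rmorphXn /= map_polyX -/(q L) in splitLq.
(* Hence [m - 1] is [-1] in [L], which makes ['X^(m.-1) - 1] separable and the roots distinct. *)
have m0 : m%:R = 0 :> L.
  have [p p_pr pcharF] := finPcharP F; have pcharL : p \in [pchar L] by rewrite pchar_lalg.
  apply/eqP; rewrite -(dvdn_pcharf pcharL) /m (card_pprimeChar pcharF) -expnM.
  rewrite dvdn_exp // muln_gt0 k_gt0 andbT.
  rewrite lt0n; apply: contraTneq F_gt1 => log0.
  by rewrite (card_pprimeChar pcharF) log0.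
have [zs DqL defL] := splitLq.
have Uzs : uniq zs.
  rewrite -separable_prod_XsubC -(eqp_separable DqL) Dq separable_root andbC.
  rewrite /root !hornerE subr_eq0 eq_sym expr0n gtn_eqF ?oner_eq0 //=.
  rewrite cyclotomic.separable_Xn_sub_1 // -subn1 natrB ?(ltnW m_gt1) // m0 sub0r.
  by rewrite oppr_eq0 oner_eq0.
have [/= a _ Da] := finField_galois_generator (sub1v {:L}%AS).
rewrite /= dimv1 expn1 in Da.
pose Em := fixedSpace (a ^+ k)%g.
have in_zs : zs =i Em.
  move=> z; rewrite -root_prod_XsubC -(eqp_root DqL) (sameP fixedSpaceP eqP).
  rewrite /root !hornerE subr_eq0 /= /m; congr (_ == z).
  elim: (k) => [|i IHi]; first by rewrite gal_id.
  by rewrite expgSr expnSr exprM IHi galM ?Da ?memvf.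
have defEm : Em = {:L}%VS.
  apply/eqP; rewrite eqEsubv subvf -defL -[Em]subfield_closed agenvS //.
  by rewrite subv_add sub1v; apply/span_subvP=> z; rewrite in_zs.
pose fL := FinFieldExtType L.
have cardL : #|fL| = m.
  have /eq_card-> : fL =i zs by move=> z; rewrite in_zs defEm memvf.
  apply: succn_inj; rewrite (card_uniqP _) //= -(size_prod_XsubC _ id).
  by rewrite -(eqp_size DqL) size_polyDl size_polyXn // size_polyN size_polyX.
have dimL : \dim {:L} = k.
  apply/eqP; rewrite -(eqn_exp2l _ _ F_gt1) -/m -cardL; apply/eqP.
  have <- := @card_vspace F fL (Vector.class L) {:L}%VS.
  by apply: eq_card => x; rewrite memvf.
pose iota : {rmorphism F -> fL} := in_alg L.
exists fL, iota, (fun i => (vbasis {:L})`_i); split=> // y.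
  move=> y_fix; have : y \in (1%AS : {subfield L}).
    by rewrite Fermat's_little_theorem dimv1 expn1; apply/eqP.
  by case/vlineP=> c ->; exists c.
exists (fun i => coord (vbasis {:L}) (cast_ord (esym dimL) i) y).
rewrite {1}(coord_vbasis (memvf (y : L))).
rewrite (reindex _ (onW_bij _ (Bijective (cast_ordKV dimL) (cast_ordK dimL)))) /=.
by apply: eq_bigr => i _; rewrite /iota /= mulr_algl.
Qed.

(** * Subspaces of fixed dimension under the action of GL_n(F) *)

Section Subspaces.
Variables (F : finFieldType) (n : nat).
Implicit Types A B g : 'M[F]_n.

Lemma LkP (k : nat) A : reflect (<<A>>%MS = A /\ \rank A = k) (A \in Lk F n k).
Proof. by rewrite inE; apply: (iffP andP) => -[/eqP-> /eqP->]. Qed.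

Lemma genmx_Lk {p : nat} {C : 'M[F]_(p, n)} : <<C>>%MS \in Lk F n (\rank C).
Proof. by apply/LkP; rewrite genmx_id genmxE. Qed.

(** The first [\rank C] rows of [row_ebase C] span the row space of [C]; taking [k] rows enlarges it
    to dimension [k]. *)
Lemma sub_Lk {k : nat} (C : 'M[F]_(k, n)) : (k <= n)%N ->
  exists2 A, A \in Lk F n k & (C <= A)%MS.
Proof.
move=> le_kn; pose D : 'M_n := pid_mx k *m row_ebase C.
have rankD : \rank D = k.
  by rewrite mxrankMfree ?rank_pid_mx // row_free_unit row_ebase_unit.
exists <<D>>%MS; first by rewrite -rankD genmx_Lk.
rewrite genmxE -{1}(mulmx_ebase C); apply/submxP.
exists (col_ebase C *m pid_mx (\rank C)).
rewrite /D mulmxA; congr (_ *m _); rewrite -mulmxA mul_pid_mx.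
congr (_ *m pid_mx _); have := rank_leq_row C; lia.
Qed.

Lemma Lk_transitive {k : nat} A B : A \in Lk F n k -> B \in Lk F n k ->
  exists2 h, h \in unitmx & <<A *m h>>%MS = B.
Proof.
move=> /LkP[_ rA] /LkP[genB rB].
exists (invmx (row_ebase A) *m row_ebase B).
  by rewrite unitmx_mul unitmx_inv !row_ebase_unit.
pose D : 'M_n := pid_mx (\rank B) *m row_ebase B.
have eqBD : (B :=: D)%MS.
  rewrite -{1}(mulmx_ebase B) -mulmxA; apply: eqmxMfull.
  by rewrite row_full_unit col_ebase_unit.
rewrite -[RHS]genB; apply/eq_genmx/eqmx_trans/eqmx_sym/eqBD.
rewrite -{1}(mulmx_ebase A) !mulmxA mulmxK ?row_ebase_unit // rA -rB -mulmxA.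
by apply: eqmxMfull; rewrite row_full_unit col_ebase_unit.
Qed.

Lemma mulmx_Lk {k : nat} A g : A \in Lk F n k -> g \in unitmx ->
  <<A *m g>>%MS \in Lk F n k.
Proof.
move=> /LkP[_ <-] g_unit; rewrite -(mxrankMfree A (B := g)) ?row_free_unit //.
exact: genmx_Lk.
Qed.

(** By transitivity all fibres of [g |-> <<A *m g>>%MS] over the [k]-dimensional subspaces have the
    same size: a uniform [g] yields a uniform subspace. Denominators are cleared. *)
Lemma card_unitmx_Lk (k : nat) A (D : {set 'M[F]_n}) :
    A \in Lk F n k -> D \subset Lk F n k ->
  (#|[set g : 'M[F]_n in unitmx | <<A *m g>>%MS \in D]| * #|Lk F n k|
     = #|D| * #|[set g : 'M[F]_n in unitmx]|)%N.
Proof.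
move=> ALk sDL.
pose fib B := [set g : 'M[F]_n in unitmx | <<A *m g>>%MS == B].
have fib_le B C : B \in Lk F n k -> C \in Lk F n k -> (#|fib B| <= #|fib C|)%N.
  move=> BLk CLk; have [h h_unit BhC] := Lk_transitive _ _ BLk CLk.
  rewrite -(card_imset (mem (fib B)) (can_inj (mulmxK h_unit))).
  apply/subset_leq_card/subsetP => _ /imsetP[g + ->]; rewrite !inE.
  case/andP=> g_unit /eqP AgB; rewrite unitmx_mul g_unit h_unit /=.
  rewrite -BhC; apply/eqP/eq_genmx; rewrite mulmxA; apply: eqmxMr.
  by rewrite -AgB; apply/eqmx_sym/genmxE.
have fibE B : B \in Lk F n k -> #|fib B| = #|fib A|.
  by move=> BLk; apply/eqP; rewrite eqn_leq !fib_le.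
have card_fib (E : {set 'M[F]_n}) : E \subset Lk F n k ->
  #|[set g : 'M[F]_n in unitmx | <<A *m g>>%MS \in E]| = (#|E| * #|fib A|)%N.
  move=> sEL; rewrite -sum_nat_const -sum1_card.
  rewrite (partition_big (fun g => <<A *m g>>%MS) (mem E)) /=; last first.
    by move=> g; rewrite inE => /andP[].
  apply: eq_bigr => B BE; rewrite -(fibE B) ?(subsetP sEL) // -sum1_card.
  apply: eq_bigl => g; rewrite !inE; case: eqP => [->|]; rewrite ?andbF //.
  by rewrite BE andbT.
rewrite (card_fib D) //.
have -> : [set g : 'M[F]_n in unitmx] =
    [set g : 'M[F]_n in unitmx | <<A *m g>>%MS \in Lk F n k].
  apply/setP => g; rewrite !inE; case: (boolP (g \in unitmx)) => //= g_unit.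
  by have := mulmx_Lk _ _ ALk g_unit; rewrite inE.
by rewrite card_fib // -mulnA [(#|fib A| * _)%N]mulnC.
Qed.

End Subspaces.

(** * The trace map *)

(** The last clause writes every function [t |-> tau (t * y)] through the same [k] functions, which
    confines a trace curve to a subspace of dimension at most [k]. *)
Lemma trace_extension (F : finFieldType) (k : nat) : (0 < k)%N ->
  exists (L : finFieldType) (iota : {rmorphism F -> L}) (tau : L -> F)
         (b : 'I_k -> L),
    [/\ #|L| = (#|F| ^ k)%N,
        forall x, iota (tau x) = \sum_(j < k) x ^+ (#|F| ^ j)
      & forall y, exists c : 'I_k -> F,
          forall t, tau (t * y) = \sum_i tau (t * b i) * c i].
Proof.
move=> k_gt0; have [L [iota [b [cardL fixL spanL]]]] := finField_extension F k k_gt0.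
have [p p_pr pcharF] := finPcharP F.
have frobD j (x y : L) : (x + y) ^+ (#|F| ^ j) = x ^+ (#|F| ^ j) + y ^+ (#|F| ^ j).
  apply: exprDn_pchar; rewrite (card_pprimeChar pcharF) -expnM pnatX.
  by rewrite pnatE // (rmorph_pchar iota pcharF).
pose tr (x : L) := \sum_(j < k) x ^+ (#|F| ^ j).
have trD x y : tr (x + y) = tr x + tr y.
  by rewrite /tr -big_split; apply: eq_bigr => j _; rewrite frobD.
have frobF j c : iota c ^+ (#|F| ^ j) = iota c.
  by elim: j => [|j IHj] //; rewrite expnSr exprM IHj -rmorphXn expf_card.
have trZ c x : tr (x * iota c) = tr x * iota c.
  rewrite /tr big_distrl; apply: eq_bigr => j _ /=.
  by rewrite exprMn frobF.
(* Frobenius permutes the summands of the trace cyclically, because [x ^+ #|L| = x]; fixed elements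
   come from [F]. *)
have tr_fix x : tr x ^+ #|F| = tr x.
  have -> : tr x ^+ #|F| = \sum_(j < k) x ^+ (#|F| ^ j.+1).
    pose f (y : L) := y ^+ #|F|.
    have fD y z : f (y + z) = f y + f z by rewrite /f -[#|F|]expn1 frobD.
    have f0 : f 0 = 0 by rewrite /f expr0n gtn_eqF // (ltnW (finNzRing_gt1 F)).
    rewrite -/(f (tr x)) /tr (big_morph f fD f0).
    by apply: eq_bigr => j _; rewrite expnSr exprM.
  rewrite /tr; case: (k) k_gt0 cardL => // k' _ cardL.
  rewrite big_ord_recr [RHS]big_ord_recl /= -cardL expf_card addrC.
  by rewrite expn0 expr1.
have /fin_all_exists[tau tauP] : forall x, exists c, iota c = tr x.
  by move=> x; apply/fixL/tr_fix.
exists L, iota, tau, b; split=> // y; have [c ->] := spanL y; exists c => t.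
apply: (fmorph_inj iota); rewrite tauP rmorph_sum big_distrr /=.
have tr0 : tr 0 = 0 by apply: (addrI (tr 0)); rewrite -trD !addr0.
rewrite (big_morph tr trD tr0); apply: eq_bigr => i _.
by rewrite rmorphM tauP mulrCA mulrC trZ.
Qed.

(** * Exponent vectors and rich trace curves *)

Definition exponents (n D : nat) : finType :=
  {e : {ffun 'I_n -> 'I_D.+1} | (\sum_i e i <= D)%N}.

Definition exponent {n D : nat} (e : exponents n D) (i : 'I_n) : nat := val e i.

Lemma card_exponents (n D : nat) : #|exponents n D| = 'C(n + D, n).
Proof.
rewrite card_sig -card_partial_ord_partitions.
pose h (e : {ffun 'I_n -> 'I_D.+1}) := [tuple e i | i < n].
have h_bij : bijective h.
  exists (fun t => [ffun i => tnth t i]) => [e|t].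
    by apply/ffunP => i; rewrite ffunE tnth_mktuple.
  by apply: eq_from_tnth => i; rewrite tnth_mktuple ffunE.
rewrite -(on_card_preimset (onW_bij _ h_bij)); apply: eq_card => e.
rewrite !inE big_tuple; congr (_ <= _)%N.
by apply: eq_bigr => i _; rewrite tnth_mktuple.
Qed.

Lemma exponentsP {n D : nat} (a : 'I_n -> nat) : (\sum_i a i <= D)%N ->
  exists e : exponents n D, forall i, a i = exponent e i.
Proof.
move=> le_a; pose e := [ffun i => inord (a i) : 'I_D.+1].
have eE i : a i = e i.
  by rewrite ffunE inordK // ltnS (leq_trans (leq_sum_term a i)).
have le_e : (\sum_i e i <= D)%N by rewrite -(eq_bigr _ (fun i _ => eE i)).
by exists (Sub e le_e).
Qed.

(** Average over the translates [x] in the flat: for each [t] the point [x + phi t] runs through the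
    whole flat, so the counts sum to [#|T| * flat_meet K a A], and the best [x] attains the
    average. *)
Lemma rich_translate {R : realDomainType} {F : finFieldType} {n : nat} {T : finType}
    (K : {set 'rV[F]_n}) (a : 'rV[F]_n) (A : 'M[F]_n) (phi : T -> 'rV[F]_n)
    (rho : R) :
    (forall t, phi t <= A)%MS -> rho <= (flat_meet K a A)%:R ->
  exists a', #|T|%:R * rho <=
    (#|F| ^ \rank A)%:R * #|[set t | a' + phi t \in K]|%:R.
Proof.
move=> phiA rho_le; pose V := [set x | (x - a <= A)%MS].
have cardV : (#|V| <= #|F| ^ \rank A)%N.
  rewrite -[\rank A]mul1n -card_mx.
  rewrite -(card_imset _ (addIr (- a))) /=.
  apply: leq_trans (leq_imset_card (fun y => y *m row_base A) _).
  apply/subset_leq_card/subsetP => _ /imsetP[x + ->]; rewrite inE.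
  by rewrite -(eq_row_base A) => /submxP[y ->]; apply: imset_f.
have sumV : (\sum_(x in V) #|[set t | (x + phi t)%R \in K]| =
    #|T| * flat_meet K a A)%N.
  under eq_bigr do rewrite -sum1_card big_mkcond.
  rewrite exchange_big -sum_nat_const; apply: eq_bigr => t _ /=.
  rewrite /flat_meet -sum1_card -big_mkcondr (reindex_inj (addIr (- phi t))) /=.
  apply: eq_bigl => x; rewrite !inE subrK andbC; congr (_ && _).
  rewrite addrAC; apply/idP/idP => [xA|xA]; last first.
    by rewrite addmx_sub // eqmx_opp.
  by rewrite -[(x - a)%R](subrK (phi t)) addmx_sub.
have aV : a \in V by rewrite inE subrr sub0mx.
have [a' /= _ a'_max] := @arg_maxnP _ a (mem V)
  (fun x => #|[set t | (x + phi t)%R \in K]|) aV.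
exists a'; rewrite (le_trans (ler_wpM2l _ rho_le)) // -!natrM ler_nat -sumV.
apply: leq_trans (leq_mul cardV (leqnn _)); rewrite -sum_nat_const.
exact: leq_sum.
Qed.

Section RichDirections.
Variables (F L : finFieldType) (iota : {rmorphism F -> L}) (tau : L -> F).
Variables (n k : nat).
Hypothesis cardL : #|L| = (#|F| ^ k.+1)%N.
Hypothesis tauE : forall x, iota (tau x) = \sum_(j < k.+1) x ^+ (#|F| ^ j).

Definition trace_curve (w : 'I_n -> L) (t : L) : 'rV[F]_n :=
  \row_i tau (t * w i ^+ #|F|).

(* The Frobenius twist in [trace_curve] makes [w] its leading coefficient. *)
Lemma trace_curve_poly (a : 'rV[F]_n) (w : 'I_n -> L) :
  exists g : 'I_n -> {poly L},
    (forall i, top_coef (#|F| ^ k) (g i) (w i)) /\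
    forall i t, (g i).[t] = iota ((a + trace_curve w t) 0 i).
Proof.
have F_gt1 := finNzRing_gt1 F; have F_gt0 := ltnW F_gt1.
exists (fun i => (iota (a 0 i))%:P +
  \sum_(j < k.+1) (w i ^+ (#|F| ^ j.+1)) *: 'X^(#|F| ^ j)).
split=> [i|i t]; last first.
  rewrite !mxE rmorphD tauE hornerD hornerC horner_sum; congr (_ + _).
  apply: eq_bigr => j _; rewrite hornerZ hornerXn exprMn -exprM -expnS.
  by rewrite mulrC.
split.
  rewrite (leq_trans (size_polyD _ _)) // geq_max (leq_trans (size_polyC_leq1 _)) //=.
  apply: (big_ind (fun p : {poly L} => size p <= (#|F| ^ k).+1)%N) => [|u v su sv|j _].
  - by rewrite size_poly0.
  - by rewrite (leq_trans (size_polyD _ _)) // geq_max su.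
  rewrite (leq_trans (size_scale_leq _ _)) // size_polyXn ltnS.
  by rewrite leq_pexp2l // -ltnS.
rewrite coefD coefC expn_eq0 gtn_eqF // add0r coef_sum.
(* Only the summand [j = k] reaches this degree; its coefficient [w i ^+ (#|F| ^ k.+1)] is [w i] by
   the cardinality of [L]. *)
rewrite big_ord_recr big1 /= => [|j _].
  by rewrite add0r coefZ coefXn eqxx mulr1 -cardL expf_card.
by rewrite coefZ coefXn eqn_exp2l // gtn_eqF ?mulr0.
Qed.

(** The threshold is a predicate on counts, which keeps the real field out of this section. *)
Definition rich (rho : nat -> bool) (K : {set 'rV[F]_n}) (w : 'I_n -> L) : bool :=
  [exists a : 'rV[F]_n, rho #|[set t | a + trace_curve w t \in K]|].

(* Select as many rows [h t] as there are rich columns, with a nonsingular minor.  A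
   combination of the monomials [h t] vanishing to order [m] on [K] has a top degree
   part killed by that minor, so the [h t] are independent as jets on [K]. *)
Lemma card_rich_columns (D l m : nat) (rho : nat -> bool) (K : {set 'rV[F]_n})
    (w : exponents n D -> 'I_n -> L) (al : exponents n D -> 'I_n -> nat) :
    (forall s, rho s -> (D * #|F| ^ k < s * (m.+1 - l))%N) ->
    (forall i, \sum_j al i j <= l)%N ->
    (forall d : exponents n D -> L,
      (forall e : exponents n D, \sum_i d i * jet (w i) (al i) (exponent e) = 0) ->
      forall i, d i = 0) ->
  (#|[set i | rich rho K (w i)]| <= #|K| * 'C(n + m, n))%N.
Proof.
move=> rhoP le_al free_col.
pose T : finType := {i | rich rho K (w i)}.
have cols (c : T -> L) : (forall e : exponents n D, \sum_t c t *
    jet (w (val t)) (al (val t)) (exponent e) = 0) ->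
  forall t, c t = 0.
  move=> c0 t; pose d i := if insub i is Some t' then c (t' : T) else 0.
  have -> : c t = d (val t) by rewrite /d valK.
  apply: free_col => e; rewrite -[RHS](c0 e).
  rewrite (bigID (fun i => rich rho K (w i))) /= [X in _ + X]big1 ?addr0.
    rewrite (reindex_omap (op := +%R) (val : T -> _) insub) => [|i iT]; last first.
      by rewrite insubT.
    apply: eq_big => [t'|t' _]; last by rewrite /d valK.
    by rewrite valK eqxx andbT (valP t').
  by move=> i iT; rewrite /d insubN // mul0r.
have [h _ free_h] := free_transversal cols.
pose J : finType := ({x | x \in K} * exponents n m)%type.
have rows (c : T -> L) : (forall xa : J, \sum_t c t *
    jet (fun i => iota ((val xa.1 : 'rV[F]_n) 0 i)) (exponent xa.2)
      (exponent (h t)) = 0) -> forall t, c t = 0.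
  move=> c0 t; apply/eqP/negP => /negP ct.
  have [t0 ct0 t0_max] := @arg_maxnP T t (fun t => c t != 0)
    (fun t => (\sum_j exponent (h t) j)%N) ct.
  pose d := (\sum_j exponent (h t0) j)%N.
  (* The top degree part of the combination; every rich column annihilates it, so [free_h]
     contradicts [c t0 != 0]. *)
  pose c' t := if (\sum_j exponent (h t) j == d)%N then c t else 0.
  suff c'0 : c' t0 = 0 by move: c'0 ct0; rewrite /c' eqxx => ->; rewrite eqxx.
  apply: free_h => t1; have /existsP[a rich_a] := valP t1.
  have [g [top_g g_eval]] := trace_curve_poly a (w (val t1)).
  rewrite -[RHS](@top_degree_jet_eq0 _ _ _ (fun t => exponent (h t)) c d
    m l _ g _ _ _ _ top_g _ (leq_ltn_trans _ (rhoP _ rich_a)) _ (le_al (val t1))).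
  - by rewrite [RHS]big_mkcond; apply: eq_bigr => t2 _; rewrite /c'; case: ifP; rewrite ?mul0r.
  - by rewrite expn_gt0 (ltnW (finNzRing_gt1 F)).
  - exact: t0_max.
  - move=> x; rewrite inE => xK b /exponentsP[b' b'E].
    rewrite -[RHS](c0 (exist (fun x => x \in K) _ xK, b')); apply: eq_bigr => t2 _; congr (_ * _).
    by apply: eq_bigr => i _; rewrite g_eval b'E.
  - by rewrite leq_mul2r (valP (h t0)) orbT.
have [f inj_f _] := free_transversal rows.
by have := leq_card f inj_f; rewrite card_prod card_exponents !card_sig cardsE.
Qed.

End RichDirections.

(** Double count pairs of [g] in GL_n(F) and a basis jet [i] rich for [Kg g]: each [i] is rich for
    at least [beta * #|U|] matrices, and each [g] has at most [#|K| * 'C(n + m, n)] rich jets. *)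
Lemma furstenberg_count {R : realType} {F : finFieldType} {n k : nat}
    (rho beta : R) (K : {set 'rV[F]_n}) (D l m : nat) :
    (k < n)%N -> (D < #|F| ^ k.+1 * l.+1)%N ->
    (forall s : nat, rho <= s%:R -> (D * #|F| ^ k < s * (m.+1 - l))%N) ->
    @furstenberg R F n k.+1 rho beta K ->
  beta * 'C(n + D, n)%:R <= #|K|%:R * 'C(n + m, n)%:R.
Proof.
move=> lt_kn lt_D rhoP furstK.
have [L [iota [tau [b [cardL tauE tau_span]]]]] := trace_extension F k.+1 isT.
pose C : finType := {y : {ffun 'I_n -> L * 'I_l.+1} | (\sum_i (y i).2 <= l)%N}.
pose B (e : exponents n D) (y : C) : L :=
  jet (fun i => (val y i).1) (fun i => (val y i).2) (exponent e).
have rowsB (c : exponents n D -> L) :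
    (forall y, \sum_e c e * B e y = 0) -> forall e, c e = 0.
  move=> c0; apply: (@jets_determine _ _ l _ exponent c).
  - by move=> e1 e2 eq_e; apply/val_inj/ffunP => j; apply/val_inj/eq_e.
  - by move=> e; rewrite cardL (leq_ltn_trans (valP e)).
  - by move=> y le_y; rewrite -[RHS](c0 (exist _ y le_y)).
have [f _ free_f] := free_transversal rowsB.
pose w i j := (val (f i) j).1; pose al i j : nat := (val (f i) j).2.
pose Kg (g : 'M[F]_n) := [set x | x *m g \in K].
pose U := [set g : 'M[F]_n in unitmx].
pose isrich (s : nat) := rho <= s%:R.
pose richg g i := rich F L tau n isrich (Kg g) (w i).
have card_col g : g \in U ->
    (#|[set i | richg g i]| <= #|K| * 'C(n + m, n))%N.
  rewrite inE => g_unit.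
  have <- : #|Kg g| = #|K|.
    by apply: on_card_preimset; apply: onW_bij; exists (mulmx^~ (invmx g));
      [apply: mulmxK | apply: mulmxKV].
  apply: (card_rich_columns F L iota tau n k cardL tauE D l m isrich _ w al) => //.
  by move=> i; apply: (valP (f i)).
pose Good := [set A in Lk F n k.+1 |
  [exists a : 'rV[F]_n, (rho <= (flat_meet K a A)%:R)]].
have rich_col i : beta * #|U|%:R <= #|[set g in U | richg g i]|%:R.
  have /fin_all_exists[c cE] : forall j, exists c : 'I_k.+1 -> F,
    forall t, tau (t * w i j ^+ #|F|) = \sum_i tau (t * b i) * c i.
    by move=> j; apply: tau_span.
  have [A ALk sMA] := sub_Lk F n (\matrix_(i', j) c j i') lt_kn.
  have curveA t : (trace_curve F L tau n (w i) t <= A)%MS.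
    apply: submx_trans sMA; apply/submxP; exists (\row_i' tau (t * b i')).
    apply/rowP => j; rewrite !mxE cE; apply: eq_bigr => i' _.
    by rewrite !mxE.
  have sGL : Good \subset Lk F n k.+1 by apply/subsetP => A'; rewrite inE => /andP[].
  have := card_unitmx_Lk F n k.+1 A Good ALk sGL; rewrite -/U.
  set V := [set g in unitmx | _] => cardV.
  have Lk_gt0 : (0 : R) < #|Lk F n k.+1|%:R.
    by rewrite ltr0n; apply/card_gt0P; exists A.
  have : beta * #|U|%:R <= #|V|%:R.
    rewrite -(ler_pM2r Lk_gt0) -[leRHS]natrM cardV natrM mulrAC.
    by rewrite ler_wpM2r.
  move/le_trans; apply; rewrite ler_nat; apply/subset_leq_card/subsetP => g.
  rewrite !inE => /andP[g_unit /andP[AgLk /existsP[a rich_a]]].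
  rewrite g_unit /=; apply/existsP.
  have curve_g t : (trace_curve F L tau n (w i) t *m g <= <<A *m g>>)%MS.
    by rewrite genmxE submxMr.
  (* The curve moved by [g] lies in a rich subspace direction; the translate found there is pulled
     back by [invmx g]. *)
  have [a' rich_a'] := rich_translate K a <<A *m g>>%MS _ rho curve_g rich_a.
  exists (a' *m invmx g).
  move: rich_a'; have /LkP[_ ->] : <<A *m g>>%MS \in Lk F n k.+1 by rewrite inE.
  rewrite cardL ler_pM2l; last by rewrite ltr0n expn_gt0 (ltnW (finNzRing_gt1 F)).
  move/le_trans; apply; rewrite ler_nat; apply/subset_leq_card/subsetP => t.
  by rewrite !inE mulmxDl mulmxKV.
have U_gt0 : (0 : R) < #|U|%:R.
  by rewrite ltr0n; apply/card_gt0P; exists 1%:M; rewrite inE unitmx1.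
rewrite -(ler_pM2l U_gt0) -[X in _ <= _ * X]natrM.
have -> : #|U|%:R * (#|K| * 'C(n + m, n))%:R =
    \sum_(g in U) (#|K| * 'C(n + m, n))%:R :> R.
  by rewrite sumr_const -[RHS]mulr_natl.
apply: (@le_trans _ _ (\sum_(g in U) #|[set i | richg g i]|%:R)); last first.
  by apply: ler_sum => g gU; rewrite ler_nat card_col.
have -> : \sum_(g in U) #|[set i | richg g i]|%:R =
    \sum_i #|[set g in U | richg g i]|%:R :> R.
  rewrite -!natr_sum; congr _%:R.
  under eq_bigr do rewrite -sum1_card big_mkcond.
  rewrite exchange_big; apply: eq_bigr => i _ /=.
  rewrite -sum1_card -big_mkcondr; apply: eq_bigl => g.
  by rewrite !inE.
have -> : #|U|%:R * (beta * 'C(n + D, n)%:R) =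
    \sum_(i : exponents n D) beta * #|U|%:R.
  by rewrite sumr_const card_exponents -[RHS]mulr_natr mulrCA mulrA.
by apply: ler_sum => i _.
Qed.

(** * Numerical estimates and the passage to the limit *)

Lemma leq_ffact_exp (a n : nat) : ((n + a) ^_ n <= (n + a) ^ n)%N.
Proof.
rewrite ffact_prod -[X in (_ <= _ ^ X)%N]card_ord -prod_nat_const.
by apply: leq_prod => i _; apply: leq_subr.
Qed.

Lemma leq_exp_ffact (a n : nat) : (a.+1 ^ n <= (n + a) ^_ n)%N.
Proof.
rewrite ffact_prod -[X in (_ ^ X <= _)%N]card_ord -prod_nat_const.
apply: leq_prod => i _; have := ltn_ord i; lia.
Qed.

Lemma bernoulli_sub {R : realDomainType} (x : R) (n : nat) : 0 <= x <= 1 ->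
  1 - n%:R * x <= (1 - x) ^+ n.
Proof.
move=> /andP[x_ge0 x_le1]; elim: n => [|n IHn]; first by rewrite mul0r subr0.
have x'_ge0 : 0 <= 1 - x by rewrite subr_ge0.
rewrite exprSr; apply: le_trans (ler_wpM2r x'_ge0 IHn).
have nxx : 0 <= n%:R * x * x by rewrite !mulr_ge0.
rewrite mulrBl mul1r mulrBr mulr1 mulrSr mulrDl mul1r.
by rewrite opprB opprD; lra.
Qed.

(** Stands in for letting [N] tend to infinity: if [y < x], an [N.+1] above [x * a / (x - y)] gives
    a contradiction. *)
Lemma le_of_harmonic {R : archiRealFieldType} (x y a : R) : 0 <= x -> 0 <= a ->
  (forall N : nat, x * (1 - a / N.+1%:R) <= y) -> x <= y.
Proof.
move=> x_ge0 a_ge0 le_y; rewrite leNgt; apply/negP => lt_yx.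
have xy_gt0 : 0 < x - y by rewrite subr_gt0.
pose N := Num.truncn (x * a / (x - y)).
have /andP[_ lt_N] : N%:R <= x * a / (x - y) < N.+1%:R.
  by apply: truncn_itv; rewrite divr_ge0 ?mulr_ge0 // ltW.
have N_gt0 : (0 : R) < N.+1%:R by rewrite ltr0n.
have := le_y N; rewrite mulrBr mulr1 mulrA => le_yN.
move: lt_N; rewrite ltr_pdivrMr // [ltRHS]mulrC -ltr_pdivrMr //.
by rewrite ltrBrDl -ltrBrDr ltNge le_yN.
Qed.

Theorem mainTheorem13 (R : realType) (F : finFieldType) (n k : nat)
  (gamma beta : R) (K : {set 'rV[F]_n}) :
  (1 <= k)%N -> (k <= n)%N ->
  0 <= gamma <= 1 -> 0 <= beta <= 1 ->
  @furstenberg R F n k (gamma * (#|F|%:R) ^+ k) beta K ->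
  beta * gamma ^+ n * (#|F|%:R) ^+ n * (1 + ((#|F|%:R) ^+ k.-1)^-1) ^- n
    <= (#|K|)%:R.
Proof.
case: k => [//|k] _ lt_kn /andP[g_ge0 g_le1] /andP[b_ge0 b_le1] furstK /=.
have F_gt0 := ltnW (finNzRing_gt1 F).
set q : R := #|F|%:R; have q_gt0 : 0 < q by rewrite ltr0n.
have qX_gt0 j : 0 < q ^+ j by rewrite exprn_gt0.
have [g0|g_neq0] := eqVneq gamma 0.
  by rewrite g0 expr0n gtn_eqF ?(leq_ltn_trans _ lt_kn) // mulr0 !mul0r ler0n.
have g_gt0 : 0 < gamma by rewrite lt_def g_neq0.
(* The limit of [(s + l) / l.+1] for the vanishing order [s + l] chosen below. *)
pose c := 1 + q ^+ k / gamma.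
have qg_gt0 : 0 < q ^+ k / gamma by rewrite divr_gt0.
have c_gt0 : 0 < c by rewrite addr_gt0.
have count (l : nat) :
    beta * (q ^+ k.+1 * l.+1%:R) ^+ n <= #|K|%:R * (l.+1%:R * c + n%:R) ^+ n.
  (* After [l] derivatives multiplicity [s.+1] remains; exceeding [l.+1 * q ^ k / gamma] makes the
     zeros on a rich curve outnumber the degree. The degree used with it is the largest that jets of
     order [l] separate. *)
  pose s := Num.truncn (l.+1%:R * (q ^+ k / gamma)).
  have /andP[s_le lt_s] : s%:R <= l.+1%:R * (q ^+ k / gamma) < s.+1%:R.
    by apply: truncn_itv; rewrite mulr_ge0 // ltW.
  have D_gt0 : (0 < #|F| ^ k.+1 * l.+1)%N by rewrite muln_gt0 expn_gt0 F_gt0.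
  have := furstenberg_count _ _ K (#|F| ^ k.+1 * l.+1).-1 l (s + l) lt_kn
    _ _ furstK.
  rewrite prednK // => /(_ (leqnn _)).
  have rhoP s' : gamma * q ^+ k.+1 <= s'%:R ->
      ((#|F| ^ k.+1 * l.+1).-1 * #|F| ^ k < s' * ((s + l).+1 - l))%N.
    move=> le_s'; rewrite subSn ?leq_addl // addnK.
    apply: (@leq_trans (#|F| ^ k.+1 * l.+1 * #|F| ^ k)%N).
      by rewrite ltn_pmul2r ?expn_gt0 ?F_gt0 // prednK.
    rewrite -(ler_nat R) !natrM !natrX -/q.
    apply: (@le_trans _ _ (gamma * q ^+ k.+1 * s.+1%:R)); last first.
      by rewrite ler_wpM2r.
    have /ltW := lt_s; rewrite mulrA ler_pdivrMr // => le_s.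
    rewrite -mulrA (mulrC gamma) -mulrA ler_pM2l //.
    by rewrite [leRHS]mulrC.
  move=> /(_ rhoP) le_count.
  have nfact_gt0 : (0 : R) < (n`!)%:R by rewrite ltr0n fact_gt0.
  move: le_count; rewrite -(ler_pM2r nfact_gt0) -!mulrA -!natrM !bin_ffact => le_count.
  apply: le_trans (le_trans le_count _).
    rewrite ler_wpM2l // -natrX -natrM -natrX ler_nat.
    by rewrite (leq_trans _ (leq_exp_ffact _ _)) // prednK.
  rewrite natrM ler_wpM2l //; apply: (@le_trans _ _ ((n + (s + l)) ^ n)%:R).
    by rewrite ler_nat leq_ffact_exp.
  rewrite natrX lerXn2r ?nnegrE ?addr_ge0 ?mulr_ge0 ?(ltW c_gt0) //.
  by rewrite /c mulrDr mulr1 !natrD [l.+1%:R]mulrSr; lra.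
have le_Q : beta * (q ^+ k.+1) ^+ n <= #|K|%:R * c ^+ n.
  apply: (@le_of_harmonic _ _ _ (n%:R * n%:R)).
  - by rewrite mulr_ge0 // exprn_ge0 // ltW.
  - by rewrite mulr_ge0.
  move=> l; have := count l; have : (0 : R) < l.+1%:R by rewrite ltr0n.
  move: (l.+1%:R : R) => N N_gt0 count_l.
  have d_gt0 : 0 < N * c + n%:R by rewrite ltr_pwDl // mulr_gt0.
  (* Here [1 - x] is the ratio of [N * c] to [N * c + n], and Bernoulli bounds the loss in its
     [n]-th power by [n * n / N]. *)
  pose x := n%:R / (N * c + n%:R).
  have N_le : N <= N * c + n%:R.
    by rewrite -[leLHS]addr0 lerD // ler_peMr ?(ltW N_gt0) // lerDl ltW.
  have x_le : x <= n%:R / N by rewrite ler_wpM2l // lef_pV2 ?posrE.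
  have x_01 : 0 <= x <= 1.
    rewrite divr_ge0 ?(ltW d_gt0) // ler_pdivrMr // mul1r lerDr.
    by rewrite mulr_ge0 ?ltW.
  have X_ge0 : 0 <= beta * (q ^+ k.+1) ^+ n by rewrite mulr_ge0 // exprn_ge0 // ltW.
  apply: (@le_trans _ _ (beta * (q ^+ k.+1) ^+ n * (1 - x) ^+ n)).
    rewrite ler_wpM2l // (le_trans _ (bernoulli_sub x n x_01)) //.
    by rewrite lerD2l lerN2 -mulrA ler_wpM2l.
  have -> : 1 - x = N * (c / (N * c + n%:R)).
    by rewrite /x; field; rewrite gt_eqF.
  have cd_ge0 : 0 <= (c / (N * c + n%:R)) ^+ n.
    by rewrite exprn_ge0 // divr_ge0 ?ltW.
  rewrite -mulrA -exprMn [q ^+ _ * _]mulrA exprMn mulrA (le_trans (ler_wpM2r cd_ge0 count_l)) //.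
  by rewrite -mulrA -exprMn mulrCA mulfV ?gt_eqF // mulr1.
have cX_gt0 : 0 < c ^+ n by rewrite exprn_gt0.
rewrite -(ler_pM2r cX_gt0) (le_trans _ le_Q) //.
rewrite -exprVn -!mulrA ler_wpM2l // -!exprMn lerXn2r ?nnegrE ?(ltW (qX_gt0 _)) //.
  rewrite mulr_ge0 // mulr_ge0 ?(ltW q_gt0) // mulr_ge0 ?(ltW c_gt0) //.
  by rewrite invr_ge0 addr_ge0 // invr_ge0 ltW.
have qk_gt0 := qX_gt0 k; rewrite exprS; set r := q ^+ k in qk_gt0 *.
have r1_gt0 : 0 < r + 1 by rewrite addr_gt0.
(* The fraction [(gamma + r) / (r + 1)] is at most [1] because [gamma <= 1]. *)
have -> : gamma * (q * ((1 + r^-1)^-1 * c)) = q * r * ((gamma + r) / (r + 1)).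
  by rewrite /c -/r; field; rewrite ?gt_eqF // ?addr_gt0 ?invr_gt0.
by rewrite ger_pMr ?mulr_gt0 // ler_pdivrMr // mul1r addrC lerD2l.
Qed.
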